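(* Let $A\in S^{N\times k}$ be an array with entries in a set $S$ of size $s$, and let $f:S\to\mathbb{R}$ be non-constant with $\sum_{x\in S}f(x)=0$. Suppose $A$ is an $\mathrm{OA}(N,k,s,1)$, and let $\lambda=N/s^2$. Then $$\left\|X(A,f)^TX(A,f)-\mathbb{I}\right\|_F\leq \frac{\sqrt{2\,\mathrm{Unb}_{2,2}(A)}}{\lambda s},$$ and, with $\sigma_1(f)=\min_{\alpha\in\mathbb{R}}\frac{1}{s}\sum_{x\in S}|f(x)-\alpha|$ and $\sigma_2(f)=\min_{\alpha\in\mathbb{R}}\sqrt{\frac{1}{s}\sum_{x\in S}|f(x)-\alpha|^2}$, $$\left\|X(A,f)^TX(A,f)-\mathbb{I}\right\|_{\max}\leq \frac{1}{\lambda}\left(\frac{\sigma_1(f)}{\sigma_2(f)}\right)^2\mathrm{Tol}_2(A)\leq \frac{1}{\lambda}\mathrm{Tol}_2(A).$$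
   Context: $X(A,f)\in\mathbb{R}^{N\times k}$ has entries $X_{i,j}(A,f)=f(A_{i,j})/\sqrt{\sum_{i'=1}^N f(A_{i',j})^2}$; $\mathbb{I}$ is the identity, $\|\cdot\|_F$ the Frobenius norm and $\|\cdot\|_{\max}$ the maximum absolute entry. For $t\leq k$, $x\in S^t$ and $j=(j_1,\ldots,j_t)$ with $1\leq j_1<\cdots<j_t\leq k$, $n(A,x,j)=\#\{i\in[N]: A_{i,j_r}=x_r\ \forall r\}$. $A$ is an $\mathrm{OA}(N,k,s,1)$ if $n(A,x,(j))=N/s$ for all $x\in S$, $j\in[k]$. $\mathrm{Tol}_2(A)=\max_{x\in S^2,\,j_1<j_2}|n(A,x,(j_1,j_2))-N/s^2|$ and $\mathrm{Unb}_{2,2}(A)=\sum_{x\in S^2}\sum_{j_1<j_2}|n(A,x,(j_1,j_2))-N/s^2|^2$. *)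

(* Defs.v *)
From HB Require Import structures.
From mathcomp Require Import all_boot all_order all_algebra.
From mathcomp Require Import boolp classical_sets reals.
From mathcomp Require Import topology normedtype realfun derive.
From mathcomp Require Import lra.

Set Implicit Arguments.
Unset Strict Implicit.
Unset Printing Implicit Defensive.

Import Order.TTheory GRing.Theory Num.Theory numFieldNormedType.Exports.
Local Open Scope ring_scope.

Section Arrays.
Variables (S : finType) (N k : nat) (A : 'M[S]_(N, k)).

Definition occ (t : nat) (x : t.-tuple S) (j : t.-tuple 'I_k) : nat :=
  #|[pred i : 'I_N | [forall r : 'I_t, A i (tnth j r) == tnth x r]]|.

Definition is_OA1 : Prop :=
  forall (x : S) (j : 'I_k),
    (occ [tuple x] [tuple j])%:R = N%:R / #|S|%:R :> rat.

Variable R : realType.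

Definition dev2 (x : S * S) (j : 'I_k * 'I_k) : R :=
  `|(occ [tuple x.1; x.2] [tuple j.1; j.2])%:R - N%:R / #|S|%:R ^+ 2|.

(* All the terms are nonnegative, so the default 0 matters only when there is
   no pair j1 < j2, i.e. when k <= 1. *)
Definition Tol2 : R :=
  \big[Num.max/0]_(x : S * S)
    \big[Num.max/0]_(j : 'I_k * 'I_k | (j.1 < j.2)%N) dev2 x j.

Definition Unb22 : R :=
  \sum_(x : S * S) \sum_(j : 'I_k * 'I_k | (j.1 < j.2)%N) dev2 x j ^+ 2.

Definition Xmx (f : S -> R) : 'M[R]_(N, k) :=
  \matrix_(i, j) (f (A i j) / Num.sqrt (\sum_(i' < N) f (A i' j) ^+ 2)).

End Arrays.

Arguments Tol2 {S N k} A R.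
Arguments Unb22 {S N k} A R.

Definition frobenius_norm (R : realType) (m n : nat) (M : 'M[R]_(m, n)) : R :=
  Num.sqrt (\sum_(i < m) \sum_(j < n) M i j ^+ 2).

Section Deviations.
Variables (R : realType) (S : finType) (f : S -> R).

Definition mean_dev1 (alpha : R) : R :=
  #|S|%:R^-1 * \sum_(x : S) `|f x - alpha|.

Definition mean_dev2 (alpha : R) : R :=
  Num.sqrt (#|S|%:R^-1 * \sum_(x : S) `|f x - alpha| ^+ 2).

(* These infima are minima: see sigma1_min and sigma2_min. *)
Definition sigma1 : R := inf (range mean_dev1).
Definition sigma2 : R := inf (range mean_dev2).

Let M : R := \sum_(x : S) `|f x|.

Let clamp (a : R) : R := if a < - M then - M else if M < a then M else a.

Let clamp_itv a : clamp a \in `[- M, M]%R.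
Proof.
have M0 : 0 <= M by apply: sumr_ge0 => x _; exact: normr_ge0.
rewrite /clamp in_itv /=; case: ltP => h1; first lra.
by case: ltP => h2; lra.
Qed.

Let clampP a x : `|f x - clamp a| <= `|f x - a|.
Proof.
have fM : `|f x| <= M.
  rewrite /M (bigD1 x) //= lerDl; apply: sumr_ge0 => y _; exact: normr_ge0.
move: fM; rewrite ler_norml => /andP[h1 h2].
rewrite /clamp; case: ltP => h3; first by rewrite !ger0_norm; lra.
by case: ltP => h4 //; rewrite !ler0_norm; lra.
Qed.

Let inf_attained (g : R -> R) : continuous g ->
  (forall a, g (clamp a) <= g a) ->
  exists a, inf (range g) = g a /\ forall b, g a <= g b.
Proof.
move=> cg gc.
have M0 : - M <= M by have := clamp_itv 0; rewrite in_itv /=; lra.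
have [c _ cmin] := EVT_min M0 (@continuous_subspaceT _ _ `[- M, M]%classic g cg).
have gmin b : g c <= g b by apply: le_trans (gc b); apply: cmin; exact: clamp_itv.
exists c; split => //; apply/eqP; rewrite eq_le; apply/andP; split.
  apply: ge_inf; last by exists c.
  by exists (g c) => _ [b _ <-].
apply: lb_le_inf; first by exists (g c); exists c.
by move=> _ [b _ <-].
Qed.

Let cont_dev (x : S) : continuous (fun a : R => `|f x - a|).
Proof.
move=> a; apply: cvg_norm; apply: cvgB; [exact: cvg_cst | exact: cvg_id].
Qed.

Lemma sigma1_min :
  exists a, sigma1 = mean_dev1 a /\ forall b, mean_dev1 a <= mean_dev1 b.
Proof.
apply: inf_attained => [a|a].
  apply: cvgM; first exact: cvg_cst.
  by apply: cvg_big => [|x _]; [exact: add_continuous | exact: cont_dev].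
rewrite /mean_dev1 ler_wpM2l ?invr_ge0 ?ler0n //.
by apply: ler_sum => x _; exact: clampP.
Qed.

Lemma sigma2_min :
  exists a, sigma2 = mean_dev2 a /\ forall b, mean_dev2 a <= mean_dev2 b.
Proof.
apply: inf_attained => [a|a].
  apply: (@continuous_comp _ _ _
      (fun b : R => #|S|%:R^-1 * \sum_(x : S) `|f x - b| ^+ 2) Num.sqrt);
    last exact: sqrt_continuous.
  apply: cvgM; first exact: cvg_cst.
  apply: cvg_big => [|x _]; first exact: add_continuous.
  by apply: (@cvgM _ _ _ _ (fun a => `|f x - a|) (fun a => `|f x - a|));
    exact: cont_dev.
rewrite /mean_dev2 ler_wsqrtr // ler_wpM2l ?invr_ge0 ?ler0n //.
apply: ler_sum => x _; rewrite lerXn2r ?nnegrE ?normr_ge0 //; exact: clampP.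
Qed.

End Deviations.

(* Main.v *)
Require Import Defs.
From HB Require Import structures.
From mathcomp Require Import all_boot all_order all_algebra.
From mathcomp Require Import boolp classical_sets reals.
From mathcomp Require Import topology normedtype.
From mathcomp Require Import ring lra.

(** Strength 1 makes every column of [f (A i j)] sum to zero with square sum
    [(N / s) * \sum_x f x ^+ 2], so the diagonal of [X^T X - 1] vanishes. Since
    [f] has sum zero and both margins of the pair counts of two columns are
    uniform, an off-diagonal entry is, up to that normalisation,
    [\sum_(x, y) (n(x, y) - N / s ^+ 2) * (f x - a) * (f y - a)] for every
    [a]. Cauchy-Schwarz with [a = 0] gives the Frobenius bound, and the triangle
    inequality with [a] a median of [f] gives the entrywise bound. *)

Set Implicit Arguments.
Unset Strict Implicit.
Unset Printing Implicit Defensive.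

Import Order.TTheory GRing.Theory Num.Theory.
Local Open Scope ring_scope.

(** Lagrange's identity: twice the gap is the sum of all [(a i * b j - a j * b i) ^+ 2]. *)
Lemma sum_cauchy_schwarz (R : realDomainType) (I : finType) (a b : I -> R) :
  (\sum_i a i * b i) ^+ 2 <= (\sum_i a i ^+ 2) * (\sum_i b i ^+ 2).
Proof.
have H : \sum_i \sum_j (a i * b j - a j * b i) ^+ 2 =
    2 * ((\sum_i a i ^+ 2) * (\sum_i b i ^+ 2) - (\sum_i a i * b i) ^+ 2).
  have -> : \sum_i \sum_j (a i * b j - a j * b i) ^+ 2 =
      \sum_i \sum_j (a i ^+ 2 * b j ^+ 2) + \sum_i \sum_j (b i ^+ 2 * a j ^+ 2)
      - 2 * \sum_i \sum_j (a i * b i * (a j * b j)).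
    rewrite mulr_sumr -big_split -sumrB; apply: eq_bigr => i _.
    rewrite mulr_sumr -big_split -sumrB; apply: eq_bigr => j _ /=; ring.
  by rewrite -!big_distrlr /=; ring.
have : 0 <= \sum_i \sum_j (a i * b j - a j * b i) ^+ 2.
  by apply: sumr_ge0 => i _; apply: sumr_ge0 => j _; exact: sqr_ge0.
by rewrite H; lra.
Qed.

(** * Pair counts and column sums of an array of strength 1 *)

Section Counting.
Variables (R : realType) (S : finType) (N k : nat) (A : 'M[S]_(N, k)).

Lemma occ1E (x : S) (j : 'I_k) :
  occ A [tuple x] [tuple j] = #|[pred i | A i j == x]|.
Proof.
apply: eq_card => i; rewrite !inE; apply/forallP/eqP => [/(_ ord0)/eqP //|h r].
by rewrite ord1; apply/eqP.
Qed.

Lemma occ2E (x y : S) (j l : 'I_k) :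
  occ A [tuple x; y] [tuple j; l] = #|[pred i | (A i j, A i l) == (x, y)]|.
Proof.
apply: eq_card => i; rewrite !inE; apply/forallP/eqP => [h|[hj hl] r].
  have /eqP hj := h ord0; have /eqP hl := h (lift ord0 ord0).
  exact: congr2 hj hl.
by case: r => [[|[|//]] hr]; apply/eqP.
Qed.

Lemma occ2C (x y : S) (j l : 'I_k) :
  occ A [tuple x; y] [tuple j; l] = occ A [tuple y; x] [tuple l; j].
Proof.
by rewrite !occ2E; apply: eq_card => i; rewrite !inE !xpair_eqE andbC.
Qed.

Lemma dev2C (x y : S) (j l : 'I_k) :
  dev2 A R (x, y) (j, l) = dev2 A R (y, x) (l, j).
Proof. by rewrite /dev2 /= occ2C. Qed.

Lemma sum_fiber (T : finType) (p : 'I_N -> T) (h : T -> R) :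
  \sum_i h (p i) = \sum_x #|[pred i | p i == x]|%:R * h x.
Proof.
rewrite (partition_big p xpredT) //=; apply: eq_bigr => x _.
rewrite (eq_bigr (fun=> h x)) => [|i /eqP-> //].
by rewrite sumr_const mulr_natl.
Qed.

Hypothesis A_OA : is_OA1 A.

Lemma OA1_occ (x : S) (j : 'I_k) :
  #|[pred i | A i j == x]|%:R = N%:R / #|S|%:R :> R.
Proof.
(* [is_OA1] is an equation between rationals; [ratr] carries it to [R]. *)
have := congr1 (@ratr R) (A_OA x j).
by rewrite occ1E fmorph_div /= !ratr_nat.
Qed.

Lemma OA1_sum_column (h : S -> R) (j : 'I_k) :
  \sum_i h (A i j) = N%:R / #|S|%:R * \sum_x h x.
Proof.
rewrite (sum_fiber (A^~ j)) mulr_sumr.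
by apply: eq_bigr => x _; rewrite OA1_occ.
Qed.

(** Grouping rows by their pair of symbols turns the counts into the sum of
    [(f (A i j) - a) * (f (A i l) - a)] over the rows. As both columns sum to zero, the shift adds
    only [N * a ^+ 2]. The subtracted constant removes exactly this, since [f x - a] sums to
    [- (s * a)] and [N / s ^+ 2 * (s * a) ^+ 2 = N * a ^+ 2]. *)
Lemma OA1_sum_column_pair (f : S -> R) (a : R) (j l : 'I_k) :
  (0 < #|S|)%N -> \sum_x f x = 0 ->
  \sum_i f (A i j) * f (A i l) =
  \sum_(p : S * S) ((occ A [tuple p.1; p.2] [tuple j; l])%:R
     - N%:R / #|S|%:R ^+ 2) * ((f p.1 - a) * (f p.2 - a)).
Proof.
move=> S_gt0 f0; have s0 : #|S|%:R != 0 :> R by rewrite pnatr_eq0 -lt0n.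
have fa : \sum_x (f x - a) = - (#|S|%:R * a).
  by rewrite sumrB f0 sumr_const sub0r mulr_natl.
have col m : \sum_i f (A i m) = 0 by rewrite OA1_sum_column f0 mulr0.
under [RHS]eq_bigr do rewrite mulrBl; rewrite sumrB.
have -> : \sum_(p : S * S) (occ A [tuple p.1; p.2] [tuple j; l])%:R
     * ((f p.1 - a) * (f p.2 - a)) = \sum_i (f (A i j) - a) * (f (A i l) - a).
  rewrite (sum_fiber (fun i => (A i j, A i l))
            (fun p => (f p.1 - a) * (f p.2 - a))).
  by apply: eq_bigr => -[x y] _; rewrite occ2E.
rewrite -mulr_sumr -(pair_bigA _ (fun x y => (f x - a) * (f y - a))) /=.
rewrite -big_distrlr /= fa.
have -> : \sum_i (f (A i j) - a) * (f (A i l) - a) =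
    \sum_i f (A i j) * f (A i l) - a * \sum_i f (A i l)
    - a * \sum_i f (A i j) + \sum_(i < N) a ^+ 2.
  rewrite !mulr_sumr -!sumrB -big_split; apply: eq_bigr => i _ /=; ring.
rewrite !col sumr_const card_ord -mulr_natl; field; exact: s0.
Qed.

(** By strength 1 all columns have the same squared norm [D], so the two normalising factors
    multiply to [D^-1]. *)
Lemma OA1_gram (f : S -> R) (j l : 'I_k) :
  let D := N%:R / #|S|%:R * \sum_x f x ^+ 2 in
  ((Xmx A f)^T *m Xmx A f) j l = D^-1 * \sum_i f (A i j) * f (A i l).
Proof.
move=> D; have D0 : 0 <= D.
  by rewrite mulr_ge0 ?divr_ge0 ?ler0n ?sumr_ge0 // => x _; exact: sqr_ge0.
rewrite mxE mulr_sumr; apply: eq_bigr => i _; rewrite !mxE.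
rewrite !(OA1_sum_column (fun x => f x ^+ 2)) -/D.
by rewrite -[X in X^-1 * (_ * _)](sqr_sqrtr D0) expr2 invfM; ring.
Qed.

End Counting.

(** [Tol2] only sees ordered pairs of columns; for [l < j], swapping the columns together with the
    symbols gives the same deviation. *)
Lemma dev2_le_Tol2 (R : realType) (S : finType) (N k : nat)
    (A : 'M[S]_(N, k)) (p : S * S) (j l : 'I_k) :
  j != l -> dev2 A R p (j, l) <= Tol2 A R.
Proof.
move=> jl; wlog lt_jl : p j l jl / (j < l)%N.
  move=> H; case: (ltngtP j l) => [||/val_inj e]; first exact: H.
    by case: p => x y lj; rewrite dev2C; apply: H => //; rewrite eq_sym.
  by rewrite e eqxx in jl.
apply: le_trans (le_bigmax _ _ p).
by apply: (le_bigmax_cond _ (j := (j, l))).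
Qed.

(** Source of the factor 2 next to [Unb22], which sums over [j < l] only. *)
Lemma sum_offdiag (R : zmodType) (k : nat) (F : 'I_k -> 'I_k -> R) :
  (forall j l, F j l = F l j) -> (forall j, F j j = 0) ->
  \sum_j \sum_l F j l = (\sum_(j : 'I_k * 'I_k | (j.1 < j.2)%N) F j.1 j.2) *+ 2.
Proof.
move=> Fsym F0; rewrite pair_bigA mulr2n /=.
rewrite (bigID (fun j : 'I_k * 'I_k => (j.1 < j.2)%N)) /=; congr (_ + _).
rewrite (bigID (fun j : 'I_k * 'I_k => (j.2 < j.1)%N)) /= [X in _ + X]big1.
  rewrite addr0 (reindex_inj (h := fun j => (j.2, j.1))) /=.
    by apply: eq_big => [j|j _]; [case: ltngtP | exact: Fsym].
  by case=> [a b] [c d] [-> ->].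
by case=> [a b] /=; case: ltngtP => // /val_inj->.
Qed.

(** * Comparison of the mean deviations and of their minima *)

Section Sigma.
Variables (R : realType) (S : finType) (f : S -> R).

Lemma mean_dev1_ge0 a : 0 <= mean_dev1 f a.
Proof. by rewrite mulr_ge0 ?invr_ge0 ?ler0n ?sumr_ge0. Qed.

Lemma mean_dev2_sqr a :
  mean_dev2 f a ^+ 2 = #|S|%:R^-1 * \sum_x (f x - a) ^+ 2.
Proof.
rewrite sqr_sqrtr; first by under eq_bigr do rewrite real_normK ?num_real //.
by rewrite mulr_ge0 ?invr_ge0 ?ler0n ?sumr_ge0 // => x _; exact: sqr_ge0.
Qed.

(** Cauchy-Schwarz against the constant function 1, after squaring. *)
Lemma mean_dev1_le_mean_dev2 a : mean_dev1 f a <= mean_dev2 f a.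
Proof.
have [S0|S_gt0] := posnP #|S|.
  by rewrite /mean_dev1 S0 invr0 mul0r sqrtr_ge0.
have s0 : 0 < #|S|%:R :> R by rewrite ltr0n.
rewrite -(ler_pXn2r (n := 2)) ?nnegrE ?mean_dev1_ge0 ?sqrtr_ge0 //.
rewrite mean_dev2_sqr /mean_dev1 exprMn expr2 -mulrA ler_pM2l ?invr_gt0 //.
rewrite ler_pdivrMl //.
have := sum_cauchy_schwarz (fun _ : S => 1) (fun x => `|f x - a|).
under eq_bigr do rewrite mul1r.
under [X in _ <= X * _]eq_bigr do rewrite expr1n.
under [X in _ <= _ * X]eq_bigr do rewrite real_normK ?num_real //.
by rewrite sumr_const.
Qed.

Lemma sigma1_ge0 : 0 <= sigma1 f.
Proof. by have [a [-> _]] := sigma1_min f; exact: mean_dev1_ge0. Qed.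

Lemma sigma1_le_sigma2 : sigma1 f <= sigma2 f.
Proof.
have [a [-> amin]] := sigma1_min f; have [b [-> _]] := sigma2_min f.
exact: le_trans (amin b) (mean_dev1_le_mean_dev2 b).
Qed.

(** The infimum is attained at some [a], so its vanishing would force [f] to equal [a]
    everywhere. *)
Lemma sigma2_gt0 : (exists x y : S, f x <> f y) -> 0 < sigma2 f.
Proof.
move=> [x [y fxy]]; have [a [-> _]] := sigma2_min f.
rewrite lt0r sqrtr_ge0 andbT; apply/eqP => d0; apply: fxy.
have := mean_dev2_sqr a; rewrite d0 expr0n /= => /esym/eqP.
have S_gt0 : (0 < #|S|)%N by apply/card_gt0P; exists x.
rewrite mulf_eq0 invr_eq0 pnatr_eq0 -leqn0 leqNgt S_gt0 /=.
rewrite psumr_eq0 => [/allP h|z _]; last exact: sqr_ge0.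
have fa z : f z = a.
  by have := h z (mem_index_enum z); rewrite sqrf_eq0 subr_eq0 => /eqP.
by rewrite !fa.
Qed.

Lemma sigma2_sqr_le : sigma2 f ^+ 2 <= #|S|%:R^-1 * \sum_x f x ^+ 2.
Proof.
have [a [-> amin]] := sigma2_min f.
have := amin 0; rewrite -(ler_pXn2r (n := 2)) ?nnegrE ?sqrtr_ge0 //.
by rewrite (mean_dev2_sqr 0); under eq_bigr do rewrite subr0.
Qed.

End Sigma.

Theorem theorem2p23 (R : realType) (S : finType) (N k : nat)
    (A : 'M[S]_(N, k)) (f : S -> R)
    (N_gt0 : (0 < N)%N)
    (f_nonconst : exists x y : S, f x <> f y)
    (f_sum0 : \sum_(x : S) f x = 0)
    (A_OA : is_OA1 A) :
  let s : R := #|S|%:R in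
  let lambda : R := N%:R / s ^+ 2 in
  let G : 'M[R]_k := (Xmx A f)^T *m Xmx A f - 1%:M in
  [/\ frobenius_norm G <= Num.sqrt (2 * Unb22 A R) / (lambda * s),
      mx_norm G <= 1 / lambda * (sigma1 f / sigma2 f) ^+ 2 * Tol2 A R &
      1 / lambda * (sigma1 f / sigma2 f) ^+ 2 * Tol2 A R
        <= 1 / lambda * Tol2 A R].
Proof.
move=> s lambda G.
have S_gt0 : (0 < #|S|)%N.
  by case: f_nonconst => x _; apply/card_gt0P; exists x.
have s_gt0 : 0 < s by rewrite ltr0n.
have n_gt0 : 0 < N%:R :> R by rewrite ltr0n.
have lambda_gt0 : 0 < lambda by rewrite divr_gt0 ?exprn_gt0.
have sig2_gt0 := sigma2_gt0 f_nonconst.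
have sig1_ge0 := sigma1_ge0 f.
have Tol_ge0 : 0 <= Tol2 A R by exact: bigmax_ge_id.
(* [D], equal to [lambda * s * Q], is the common squared norm of the columns. *)
pose Q := \sum_x f x ^+ 2; pose D := N%:R / s * Q.
have sig2_le : s * sigma2 f ^+ 2 <= Q by rewrite -ler_pdivlMl // sigma2_sqr_le.
have Q_gt0 : 0 < Q by apply: lt_le_trans sig2_le; rewrite mulr_gt0 ?exprn_gt0.
have D_gt0 : 0 < D by rewrite mulr_gt0 ?divr_gt0.
have Gdiag j : G j j = 0.
  rewrite mxE OA1_gram // !mxE eqxx.
  rewrite (eq_bigr (fun i => f (A i j) ^+ 2)) //.
  rewrite (OA1_sum_column A_OA (fun x => f x ^+ 2)) mulVf ?subrr //.
  exact: lt0r_neq0.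
have GE a j l : j != l -> G j l = D^-1 *
    \sum_(p : S * S) ((occ A [tuple p.1; p.2] [tuple j; l])%:R - lambda)
      * ((f p.1 - a) * (f p.2 - a)).
  move=> jl; rewrite mxE OA1_gram // (OA1_sum_column_pair A_OA a) //.
  by rewrite !mxE (negPf jl) subr0.
have Gsym j l : G j l = G l j.
  have [->//|jl] := eqVneq j l.
  rewrite !mxE eq_sym; congr (_ - _).
  by apply: eq_bigr => i _; rewrite !mxE mulrC.
split.
(* Cauchy-Schwarz with shift 0: the factor from [f] is [Q ^+ 2], and
   [Q ^+ 2 / D ^+ 2 = (lambda * s) ^- 2]. *)
- have bound j l : j != l ->
      G j l ^+ 2 <= (lambda * s) ^- 2 * \sum_p dev2 A R p (j, l) ^+ 2.
    move=> jl; rewrite (GE 0 _ _ jl) exprMn.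
    have := sum_cauchy_schwarz
      (fun p : S * S => (occ A [tuple p.1; p.2] [tuple j; l])%:R - lambda)
      (fun p => (f p.1 - 0) * (f p.2 - 0)).
    have -> : \sum_(p : S * S) ((f p.1 - 0) * (f p.2 - 0)) ^+ 2 = Q ^+ 2.
      rewrite expr2 /Q big_distrlr pair_bigA /=.
      by apply: eq_bigr => p _; rewrite !subr0 exprMn.
    have -> : \sum_(p : S * S)
        ((occ A [tuple p.1; p.2] [tuple j; l])%:R - lambda) ^+ 2
        = \sum_p dev2 A R p (j, l) ^+ 2.
      by apply: eq_bigr => p _; rewrite /dev2 real_normK ?num_real.
    move=> cs; rewrite exprVn ler_pdivrMl ?exprn_gt0 //.
    apply: le_trans cs _; rewrite le_eqVlt; apply/orP; left; apply/eqP.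
    rewrite /D /lambda; field.
    by rewrite !lt0r_neq0.
  have ls_gt0 : 0 < lambda * s by rewrite mulr_gt0.
  (* Writing [lambda * s] as the root of its square reduces the claim to comparing radicands. *)
  rewrite ler_pdivlMr // -[X in _ * X]ger0_norm ?(ltW ls_gt0) // -sqrtr_sqr.
  rewrite -sqrtrM; last first.
    by apply: sumr_ge0 => i _; apply: sumr_ge0 => j _; exact: sqr_ge0.
  rewrite ler_wsqrtr // (sum_offdiag (F := fun j l => G j l ^+ 2)).
  + rewrite -[X in X * _]mulr_natl -mulrA ler_pM2l //.
    rewrite -ler_pdivlMr ?exprn_gt0 // /Unb22 exchange_big /= mulr_suml; apply: ler_sum => -[j l] /= jl.
    rewrite mulrC; apply: bound.
    by apply/eqP => e; rewrite e ltnn in jl.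
  + by move=> j l; rewrite Gsym.
  + by move=> j; rewrite Gdiag expr0n.
- rewrite mx_normrE.
  (* This covers both the default 0 of the maximum and the zero diagonal. *)
  have rhs_ge0 : 0 <= 1 / lambda * (sigma1 f / sigma2 f) ^+ 2 * Tol2 A R.
    by rewrite !mulr_ge0 ?sqr_ge0 ?invr_ge0 // ltW.
  apply: bigmax_le => // -[j l] _ /=.
  have [->|jl] := eqVneq j l; first by rewrite Gdiag normr0.
  (* Shifting by a minimiser of [mean_dev1] makes the absolute values of [f x - a] sum to
     [s * sigma1 f]; the double sum over symbols is the square of this. *)
  have [a [sig1E _]] := sigma1_min f.
  rewrite (GE a _ _ jl) normrM gtr0_norm ?invr_gt0 //.
  have le1 : `|\sum_(p : S * S)
      ((occ A [tuple p.1; p.2] [tuple j; l])%:R - lambda)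
      * ((f p.1 - a) * (f p.2 - a))| <= Tol2 A R * (s * sigma1 f) ^+ 2.
    have -> : s * sigma1 f = \sum_x `|f x - a|.
      by rewrite sig1E /mean_dev1 mulrA divff ?mul1r ?lt0r_neq0.
    rewrite expr2 big_distrlr pair_bigA /= mulr_sumr.
    apply: le_trans (ler_norm_sum _ _ _) _; apply: ler_sum => p _.
    rewrite !normrM ler_wpM2r ?mulr_ge0 //.
    exact: dev2_le_Tol2 jl.
  rewrite ler_pdivrMl //; apply: le_trans le1 _.
  (* The last factor is at least 1 by [sig2_le]. *)
  have -> : D * (1 / lambda * (sigma1 f / sigma2 f) ^+ 2 * Tol2 A R)
     = Tol2 A R * (s * sigma1 f) ^+ 2 * (Q / (s * sigma2 f ^+ 2)).
    by rewrite /D /lambda; field; rewrite !lt0r_neq0.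
  rewrite ler_peMr ?mulr_ge0 ?sqr_ge0 //.
  by rewrite ler_pdivlMr ?mul1r // mulr_gt0 ?exprn_gt0.
- have ratio_ge0 : 0 <= sigma1 f / sigma2 f by rewrite divr_ge0 // ltW.
  rewrite ler_wpM2r // ler_piMr //; first by rewrite div1r invr_ge0 ltW.
  apply: exprn_ile1 => //; rewrite ler_pdivrMr // mul1r.
  exact: sigma1_le_sigma2.
Qed.
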